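(* Let $G$ be an NSS group and let $X$ be a $G$-regular space. Then the following conditions are equivalent: (i) $X$ is pseudocompact; (ii) $C_p(X,G)$ is TAP; (iii) $C_p(X,G)$ does not contain a subgroup which is topologically isomorphic to an infinite product of nontrivial topological groups.
   Context: All spaces are Tychonoff and non-empty; all topological groups are Hausdorff, and $e$ denotes the identity of $G$. $C_p(X,G)$ is the group of all continuous maps $X\to G$ with pointwise group operations and the topology of pointwise convergence (subbase: sets $\{f: f(x)\in U\}$, $x\in X$, $U\subseteq G$ open). $X$ is $G$-regular if for every closed $F\subseteq X$ and every $x\in X\setminus F$ there exist $f\in C_p(X,G)$ and $g\in G\setminus\{e\}$ with $f(x)=g$ and $f(F)\subseteq\{e\}$. A topological group is NSS if some open neighborhood of the identity contains no nontrivial subgroup. A subset $A$ of a topological group $H$ is absolutely productive in $H$ if for every injection $a:\mathbb{N}\to A$ and every map $z:\mathbb{N}\to\mathbb{Z}$ the sequence $\left(\prod_{n=0}^{k}a(n)^{z(n)}\right)_{k\in\mathbb{N}}$ converges in $H$. $H$ is TAP if every absolutely productive subset of $H$ is finite. *)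

(* Defs.v *)
From HB Require Import structures.
From mathcomp Require Import all_boot all_order all_algebra.
From mathcomp Require Import all_classical all_reals.
From mathcomp Require Import topology.
From mathcomp Require Import Rstruct Rstruct_topology.

Set Implicit Arguments.
Unset Strict Implicit.
Unset Printing Implicit Defensive.

Import Order.TTheory GRing.Theory Num.Theory.
Local Open Scope classical_set_scope.
Local Open Scope ring_scope.

(** Tychonoff space: Hausdorff (T1 suffices together with the next clause)
    and completely regular (points and closed sets separated by a
    continuous real-valued function). *)
Definition tychonoff_space (X : topologicalType) : Prop :=
  hausdorff_space X /\
  forall (F : set X) (x : X), closed F -> ~ F x ->
    exists f : X -> Rdefinitions.R,
      continuous f /\ f x = 0 /\ (forall y, F y -> f y = 1).

Definition pseudocompact (X : topologicalType) : Prop :=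
  forall f : X -> Rdefinitions.R, continuous f ->
    exists M : Rdefinitions.R, forall x, `|f x| <= M.

Definition is_topgroup (T : topologicalType) (mul : T -> T -> T)
    (inv : T -> T) (e : T) : Prop :=
  [/\ (forall x y z, mul x (mul y z) = mul (mul x y) z),
      (forall x, mul e x = x /\ mul x e = x) /\
      (forall x, mul (inv x) x = e /\ mul x (inv x) = e),
      continuous (fun p : T * T => mul p.1 p.2),
      continuous inv &
      hausdorff_space T].

Record topGroup := TopGroup {
  tg_car :> topologicalType;
  tg_mul : tg_car -> tg_car -> tg_car;
  tg_inv : tg_car -> tg_car;
  tg_one : tg_car;
  tg_ax : is_topgroup tg_mul tg_inv tg_one }.

Definition is_subgroup (G : topGroup) (S : set G) : Prop :=
  S (tg_one G) /\
  (forall x y, S x -> S y -> S (tg_mul x y)) /\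
  (forall x, S x -> S (tg_inv x)).

Definition NSS (G : topGroup) : Prop :=
  exists U : set G, [/\ open U, U (tg_one G) &
    forall S : set G, is_subgroup S -> S `<=` U -> S = [set tg_one G]].

Definition G_regular (G : topGroup) (X : topologicalType) : Prop :=
  forall (F : set X) (x : X), closed F -> ~ F x ->
    exists (f : X -> G) (g : G),
      [/\ continuous f, g <> tg_one G, f x = g &
          forall y, F y -> f y = tg_one G].

Section GroupNotions.
Variables (T : topologicalType) (mul : T -> T -> T) (inv : T -> T) (e : T).

Definition zpow (x : T) (z : int) : T :=
  match z with
  | Posz n => iter n (mul x) e
  | Negz n => inv (iter n.+1 (mul x) e)
  end.

Fixpoint pprod (f : nat -> T) (k : nat) : T :=
  match k with
  | 0%N => f 0%N
  | k'.+1 => mul (pprod f k') (f k)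
  end.

Definition absolutely_productive (A : set T) : Prop :=
  forall (a : nat -> T), injective a -> (forall n, A (a n)) ->
  forall z : nat -> int,
    exists l : T, pprod (fun n => zpow (a n) (z n)) @ \oo --> l.

Definition TAP : Prop :=
  forall A : set T, absolutely_productive A -> finite_set A.

End GroupNotions.

Definition cont_set (X : topologicalType) (G : topologicalType) :
  set {ptws X -> G} := [set f | continuous (f : X -> G)].
Arguments cont_set : clear implicits.

Definition Cp (X : topologicalType) (G : topGroup) : topologicalType :=
  set_type (cont_set X G).

Section CpOps.
Variables (X : topologicalType) (G : topGroup).

Lemma cont_mul (f g : X -> G) : continuous f -> continuous g ->
  continuous (fun x => tg_mul (f x) (g x)).
Proof.
move=> cf cg x; apply: continuous2_cvg; [|exact: cf|exact: cg].
by case: (tg_ax G) => _ _ cm _ _; exact: (cm (f x, g x)).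
Qed.

Lemma cont_inv (f : X -> G) : continuous f ->
  continuous (fun x => tg_inv (f x)).
Proof.
move=> cf x; case: (tg_ax G) => _ _ _ ci _.
exact: (continuous_comp (cf x) (ci (f x))).
Qed.

Definition Cp_mul (f g : Cp X G) : Cp X G :=
  exist _ (fun x => tg_mul (sval f x) (sval g x) : G)
    (mem_set (cont_mul (set_mem (svalP f)) (set_mem (svalP g)))).

Definition Cp_inv (f : Cp X G) : Cp X G :=
  exist _ (fun x => tg_inv (sval f x) : G)
    (mem_set (cont_inv (set_mem (svalP f)))).

Definition Cp_one : Cp X G :=
  exist _ (fun _ => tg_one G : G) (mem_set (@cst_continuous X G (tg_one G))).

End CpOps.

Definition prodG (I : Type) (H : I -> topGroup) : topologicalType :=
  prod_topology (fun i => tg_car (H i)).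

Definition prodG_mul (I : Type) (H : I -> topGroup) (a b : prodG H) : prodG H :=
  fun i => tg_mul (a i) (b i).

(** C_p(X,G) contains a subgroup topologically isomorphic to an infinite
    product of nontrivial topological groups: there is an injective
    continuous group homomorphism phi from the product into C_p(X,G)
    which is open onto its image (the image, a subgroup, carrying the
    subspace topology). *)
Definition Cp_contains_infinite_product (X : topologicalType) (G : topGroup)
  : Prop :=
  exists (I : Type) (H : I -> topGroup) (phi : prodG H -> Cp X G),
    [/\ infinite_set [set: I] /\
        (forall i, exists h : H i, h <> tg_one (H i)),
        (forall a b, phi (prodG_mul a b) = Cp_mul (phi a) (phi b)),
        injective phi,
        continuous phi &
        (forall U : set (prodG H), open U ->
           exists V : set (Cp X G), open V /\ phi @` U = V `&` range phi)].

(* Main.v *)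
Require Import Defs.
From HB Require Import structures.
From mathcomp Require Import all_boot all_order all_algebra.
From mathcomp Require Import zify lra.
From mathcomp Require Import all_classical all_reals.
From mathcomp Require Import topology normedtype.
From mathcomp Require Import Rstruct Rstruct_topology.

(** Suppose [X] is pseudocompact and [a] is an injective sequence in an
    absolutely productive subset of [C_p(X,G)]. By NSS, at each point almost all
    the [a n] are trivial, so after passing to a subsequence there are points
    [x k] with [a k (x k) <> e] and [a j (x k) = e] for [j > k]. For each start
    index [N], greedily chosen exponents supported on [N, oo) give an infinite
    product [l N], a continuous map, whose value at every [x k], [k >= N], avoids
    a fixed neighbourhood of [e]. Finitely many of the [l N] are nearly constant
    on a neighbourhood [O k] of [x k]; by pseudocompactness the [O k] accumulate
    at some [p]. If all [a n] with [n >= N] are trivial at [p], then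
    [l N p = e], which contradicts the continuity of [l N].

    An infinite product of nontrivial groups contains an infinite absolutely
    productive set: one nontrivial element in each factor.

    If [f] is unbounded on [X], its level sets provide an infinite discrete
    family of nonempty open sets [O n]; the product over [n] of the groups of
    continuous maps supported in [O n] embeds in [C_p(X,G)] by gluing, and these
    groups are nontrivial by [G]-regularity. *)

Set Implicit Arguments.
Unset Strict Implicit.
Unset Printing Implicit Defensive.

Import Order.TTheory GRing.Theory Num.Theory.
Import numFieldNormedType.Exports.
Local Open Scope classical_set_scope.
Local Open Scope ring_scope.

(** * Locally finite sums and cluster points in pseudocompact spaces *)

Section UnboundedSums.
Variables (R : realType) (X : topologicalType).

Lemma sum_ord_vanish (f : nat -> R) (m n : nat) :
  (forall k, (m <= k)%N -> f k = 0) -> (forall k, (n <= k)%N -> f k = 0) ->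
  \sum_(k < m) f k = \sum_(k < n) f k.
Proof.
wlog mn : m n / (m <= n)%N.
  move=> H fm fn; have [/H|/ltnW/H] := leqP m n; first exact.
  by move=> H'; apply/esym/H'.
move=> fm _; rewrite -!(big_mkord xpredT) (big_cat_nat (leq0n m) mn) /=.
rewrite [X in _ = _ + X]big_nat_cond [X in _ = _ + X]big1 ?addr0 // => k.
by case/andP => /andP[mk _] _; apply: fm.
Qed.

Lemma continuous_sum_ord (f : nat -> X -> R) (n : nat) :
  (forall k, continuous (f k)) -> continuous (fun x => \sum_(k < n) f k x).
Proof.
move=> cf; elim: n => [|n IH].
  have -> : (fun x => \sum_(k < 0) f k x) = fun=> 0.
    by apply/funext => x; rewrite big_ord0.
  exact: cst_continuous.
have -> : (fun x => \sum_(k < n.+1) f k x) =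
    fun x => \sum_(k < n) f k x + f n x.
  by apply/funext => x; rewrite big_ord_recr.
by move=> x; apply: cvgD; [exact: IH|exact: cf].
Qed.

(** The bump [1 - f k] lives in [O k] and equals 1 at [x k]. Scaling it by [k] and summing gives a
    locally finite sum of nonnegative terms, at least [k] at [x k]. *)
Lemma locally_finite_unbounded (O : nat -> set X) (x : nat -> X)
    (f : nat -> X -> R) :
  (forall k, continuous (f k)) -> (forall k, f k (x k) = 0) ->
  (forall k y, ~ O k y -> f k y = 1) ->
  (forall p : X, exists2 B : set X, nbhs p B &
     exists N, forall k, (N <= k)%N -> B `&` O k = set0) ->
  exists2 F : X -> R, continuous F & forall M : R, exists y, M < F y.
Proof.
move=> cf fx fO lf.
have Ox k : O k (x k).
  by apply: contrapT => /(fO k)/eqP; rewrite fx eq_sym oner_eq0.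
pose g k y := `|(1 - f k y) *+ k|.
have cg k : continuous (g k).
  move=> y; apply: cvg_norm; apply: cvgMn; apply: cvgB; first exact: cvg_cst.
  exact: cf.
have {lf} /choice[N HN] : forall p : X, exists N, exists2 B : set X, nbhs p B &
    forall y, B y -> forall k, (N <= k)%N -> g k y = 0.
  move=> p; have [B pB [N BN]] := lf p; exists N, B => // y By k Nk.
  rewrite /g fO ?subrr ?mul0rn ?normr0 // => Oy.
  by have := BN _ Nk; rewrite -subset0 => /(_ y); apply.
have Ng p k : (N p <= k)%N -> g k p = 0.
  by have [B /nbhs_singleton Bp] := HN p; apply.
(* The truncation [N y] need not depend continuously on [y]. Near [p] all terms from [N p] on
   vanish, so the length can be frozen there. *)
pose F y := \sum_(k < N y) g k y.
exists F.
  move=> p; have [B pB BN] := HN p.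
  change (F @ p --> \sum_(k < N p) g k p).
  apply: cvg_trans (continuous_sum_ord (n := N p) cg (x := p)).
  apply: near_eq_cvg; apply: filterS pB => y By.
  by rewrite /F (@sum_ord_vanish (g^~ y) (N p) (N y)) // => k; [exact: BN|exact: Ng].
move=> M; pose k := (Num.bound `|M|); exists (x k).
(* Otherwise the term [g k (x k) = k] would vanish, while [k] exceeds the absolute value of [M]. *)
have kN : (k < N (x k))%N.
  rewrite ltnNge; apply/negP => /Ng.
  rewrite /g fx subr0 => /eqP; rewrite normr_eq0 pnatr_eq0 => /eqP k0.
  by have := archi_boundP (normr_ge0 M); rewrite -/k k0 ltNge normr_ge0.
rewrite /F (bigD1 (Ordinal kN)) //= {1}/g fx subr0.
apply: (@lt_le_trans _ _ k%:R).
  exact: le_lt_trans (ler_norm M) (archi_boundP (normr_ge0 M)).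
rewrite ger0_norm ?ler0n // lerDl; apply: sumr_ge0 => i _; exact: normr_ge0.
Qed.

End UnboundedSums.

(** If no such [p] existed, the family [O] would be locally finite, and complete regularity would
    supply the bumps for an unbounded continuous sum. *)
Lemma pseudocompact_cluster (X : topologicalType) (O : nat -> set X)
    (x : nat -> X) :
  tychonoff_space X -> pseudocompact X -> (forall k, nbhs (x k) (O k)) ->
  exists p : X, forall B : set X, nbhs p B -> forall N, exists2 k, (N <= k)%N &
    B `&` O k !=set0.
Proof.
move=> [_ cr] pc nO; apply: contrapT => nocl.
have /choice[f Hf] : forall k, exists f : X -> Rdefinitions.R,
    [/\ continuous f, f (x k) = 0 & forall y, ~ O k y -> f y = 1].
  move=> k; have [] := cr (~` (O k)^°) (x k).
  - exact/open_closedC/open_interior.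
  - by apply; exact: nO.
  move=> f [cf [fx fO]]; exists f; split=> // y Oy; apply: fO => /interior_subset.
  exact: Oy.
have [||||F cF Fub] := @locally_finite_unbounded _ X O x f.
- by move=> k; case: (Hf k).
- by move=> k; case: (Hf k).
- by move=> k; case: (Hf k).
- move=> p; apply: contrapT => H; apply: nocl; exists p => B pB N.
  apply: contrapT => H'; apply: H; exists B => //; exists N => k Nk.
  apply/eqP/negPn/negP => /set0P BO; apply: H'; by exists k.
- have [M FM] := pc F cF; have [y My] := Fub M.
  by have := lt_le_trans My (le_trans (ler_norm _) (FM y)); rewrite ltxx.
Qed.

(** * Coordinatewise convergence in products and spaces of maps *)

Lemma initial_cvg (S : choiceType) (T : topologicalType) (f : S -> T)
    (F : set_system S) (s : S) : Filter F ->
  F --> (s : initial_topology f) <-> f @ F --> f s.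
Proof.
move=> FF; split=> cF.
  exact: cvg_comp cF (@initial_continuous _ _ f s).
move=> A [_ [[B oB <-] Bs sBA]]; apply: (filterS sBA).
by apply: cF; apply: open_nbhs_nbhs.
Qed.

Lemma prod_topology_cvg (I : Type) (K : I -> topologicalType)
    (F : set_system (prod_topology K)) (p : prod_topology K) : Filter F ->
  F --> p <-> forall i, (fun q => q i) @ F --> p i.
Proof.
move=> FF; rewrite (@cvg_sup _ I (fun i => Topological.class
  (initial_topology (fun f : forall i, K i => f i)))).
by split=> H i; apply/(@initial_cvg _ _ (fun f : forall i, K i => f i)); exact: H.
Qed.

(** The set [S] is arbitrary so that the result serves both [Cp X G] and the groups of supported
    maps. *)
Lemma set_type_ptws_cvg (X G : topologicalType) (S : set {ptws X -> G})
    (F : set_system (set_type S)) (h : set_type S) : Filter F ->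
  F --> h <-> forall x, (fun g : set_type S => sval g x) @ F --> sval h x.
Proof.
move=> FF; rewrite (@initial_cvg _ _ (@set_val _ S)).
by rewrite (@prod_topology_cvg X (fun=> G)).
Qed.

Lemma set_type_ptws_continuous (Y X G : topologicalType)
    (S : set {ptws X -> G}) (p : Y -> set_type S) :
  continuous p <-> forall x, continuous (fun y => sval (p y) x).
Proof.
split=> [cp x y|cp y].
  exact: (proj1 (@set_type_ptws_cvg _ _ S (p @ y) (p y) _)) (cp y) x.
by apply/set_type_ptws_cvg => x; exact: cp.
Qed.

Lemma set_type_ptws_eval_continuous (X G : topologicalType)
    (S : set {ptws X -> G}) (x : X) :
  continuous (fun g : set_type S => sval g x).
Proof. by apply: (proj1 (set_type_ptws_continuous _)) => g; exact: cvg_id. Qed.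

Lemma set_type_ptws_eval_cvg (Y : Type) (X G : topologicalType)
    (S : set {ptws X -> G}) (F : set_system Y) (p : Y -> set_type S)
    (h : set_type S) x :
  p @ F --> h -> (fun y => sval (p y) x) @ F --> sval h x.
Proof.
by move=> ph; exact: cvg_comp ph (@set_type_ptws_eval_continuous _ _ S x h).
Qed.

Lemma set_type_ptws_hausdorff (X G : topologicalType) (S : set {ptws X -> G}) :
  hausdorff_space G -> hausdorff_space (set_type S).
Proof.
move=> hG f g clfg; apply: val_inj; apply/funext => x; apply: hG => A B fA gB.
have [h [Ah Bh]] := clfg _ _ (@set_type_ptws_eval_continuous _ _ S x f _ fA)
  (@set_type_ptws_eval_continuous _ _ S x g _ gB).
by exists (sval h x).
Qed.

(** * Powers, finite products and the NSS property in topological groups *)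

Section TopGroupTheory.
Variable G : topGroup.
Local Notation "x ** y" := (tg_mul x y) (at level 40, left associativity).
Local Notation "x ^-" := (tg_inv x) (at level 3, format "x ^-").
Local Notation e := (tg_one G).
Local Notation zp := (zpow (@tg_mul G) (@tg_inv G) e).
Implicit Types x y g : G.

Lemma tg_mulA x y z : x ** (y ** z) = x ** y ** z.
Proof. by case: (tg_ax G). Qed.

Lemma tg_mul1g x : e ** x = x.
Proof. by case: (tg_ax G) => _ [/(_ x)[]]. Qed.

Lemma tg_mulg1 x : x ** e = x.
Proof. by case: (tg_ax G) => _ [/(_ x)[]]. Qed.

Lemma tg_mulVg x : x^- ** x = e.
Proof. by case: (tg_ax G) => _ [_ /(_ x)[]]. Qed.

Lemma tg_mulgV x : x ** x^- = e.
Proof. by case: (tg_ax G) => _ [_ /(_ x)[]]. Qed.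

Lemma tg_hausdorff : hausdorff_space G.
Proof. by case: (tg_ax G). Qed.

Lemma tg_mul_cvg (T : Type) (F : set_system T) (f h : T -> G) x y :
  Filter F -> f @ F --> x -> h @ F --> y ->
  (fun t => f t ** h t) @ F --> x ** y.
Proof.
move=> FF fx hy; apply: continuous2_cvg fx hy.
by case: (tg_ax G) => _ _ cm _ _; exact: (cm (x, y)).
Qed.

Lemma tg_inv_cvg (T : Type) (F : set_system T) (f : T -> G) x :
  Filter F -> f @ F --> x -> (fun t => (f t)^-) @ F --> x^-.
Proof.
move=> FF fx; apply: cvg_comp fx _.
by case: (tg_ax G) => _ _ _ ci _; exact: ci.
Qed.

Lemma tg_mulI x y z : x ** y = x ** z -> y = z.
Proof.
by move=> /(congr1 (tg_mul x^-)); rewrite !tg_mulA tg_mulVg !tg_mul1g.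
Qed.

Lemma tg_idem1 x : x ** x = x -> x = e.
Proof. by rewrite -{3}(tg_mulg1 x) => /tg_mulI. Qed.

Lemma tg_inv_uniq x y : x ** y = e -> y = x^-.
Proof. by rewrite -(tg_mulgV x) => /tg_mulI. Qed.

Lemma tg_inv1 : e^- = e :> G.
Proof. by apply/esym/tg_inv_uniq; exact: tg_mul1g. Qed.

Lemma tg_invM x y : (x ** y)^- = y^- ** x^-.
Proof.
apply/esym/tg_inv_uniq.
by rewrite tg_mulA -(tg_mulA x) tg_mulgV tg_mulg1 tg_mulgV.
Qed.

Lemma zpow1 g : zp g 1 = g.
Proof. exact: tg_mulg1. Qed.

Lemma zpow_one (z : int) : zp e z = e.
Proof.
have it n : iter n (tg_mul e) e = e by elim: n => //= n ->; exact: tg_mul1g.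
by case: z => n; rewrite /zpow it ?tg_inv1.
Qed.

Lemma iter_mul_comm g n : iter n (tg_mul g) e ** g = g ** iter n (tg_mul g) e.
Proof.
by elim: n => /= [|n IH]; rewrite ?tg_mul1g ?tg_mulg1 // -tg_mulA IH.
Qed.

Lemma zpowS g (z : int) : zp g (1 + z) = g ** zp g z.
Proof.
(* [Negz n] stands for [-(n+1)], so the passage from -1 to 0 is a case of its own. *)
case: z => [n|[|n]] //.
  by rewrite /zpow /= tg_mulg1 tg_mulgV.
have -> : 1 + Negz n.+1 = Negz n by rewrite !NegzE; lia.
rewrite /zpow [iter n.+2 _ _]iterS -iter_mul_comm tg_invM tg_mulA tg_mulgV.
by rewrite tg_mul1g.
Qed.

Lemma zpowD g (a b : int) : zp g (a + b) = zp g a ** zp g b.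
Proof.
elim: a => [|n IH|n IH]; first by rewrite add0r tg_mul1g.
  by rewrite intS -addrA !zpowS IH tg_mulA.
(* Multiplying by [g] on the left reduces the exponent [-(n+1)] to [-n]. *)
apply: (@tg_mulI g); rewrite tg_mulA -!zpowS.
have -> : 1 + - n.+1%:Z = - n%:Z by lia.
by rewrite -IH; congr zp; lia.
Qed.

Lemma zpowN g (a : int) : zp g (- a) = (zp g a)^-.
Proof. by apply: tg_inv_uniq; rewrite -zpowD subrr. Qed.

(** If all powers of [g] stayed in [U], they would form a subgroup inside [U], hence a trivial
    one. *)
Lemma zpow_escape (U : set G) g :
  (forall S : set G, is_subgroup S -> S `<=` U -> S = [set e]) ->
  g <> e -> exists z, ~ U (zp g z).
Proof.
move=> nss ge; apply: contrapT => H; apply: ge.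
suff : [set e] g by [].
rewrite -(nss (range (zp g))); first by exists 1 => //; exact: zpow1.
  split; first by exists 0.
  split=> [_ _ [a _ <-] [b _ <-]|_ [a _ <-]].
    by exists (a + b) => //; rewrite zpowD.
  by exists (- a) => //; rewrite zpowN.
by move=> _ [a _ <-]; apply: contrapT => Ua; apply: H; exists a.
Qed.

Lemma nbhs1_split (q : G -> G -> G) (U : set G) :
  (fun p : G * G => q p.1 p.2) @ (e, e) --> e -> nbhs e U ->
  exists2 V : set G, nbhs e V & forall x y, V x -> V y -> U (q x y).
Proof.
move=> cq /cq [[A B] /= [nA nB] AB]; exists (A `&` B); first exact: filterI.
by move=> x y [Ax _] [_ By]; exact: (AB (x, y)).
Qed.

Lemma nbhs1_mul (U : set G) : nbhs e U ->
  exists2 V : set G, nbhs e V & forall x y, V x -> V y -> U (x ** y).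
Proof.
apply: nbhs1_split; rewrite -{3}(tg_mul1g e).
by apply: tg_mul_cvg; [exact: cvg_fst|exact: cvg_snd].
Qed.

Lemma nbhs1_div (U : set G) : nbhs e U ->
  exists2 V : set G, nbhs e V & forall x y, V x -> V y -> U (x^- ** y).
Proof.
apply: nbhs1_split; rewrite -{3}(tg_mulVg e).
apply: tg_mul_cvg; last exact: cvg_snd.
by apply: tg_inv_cvg; exact: cvg_fst.
Qed.

Lemma pprod_const (u : nat -> G) N k : (forall n, (N < n)%N -> u n = e) ->
  (N <= k)%N -> pprod (@tg_mul G) u k = pprod (@tg_mul G) u N.
Proof.
move=> uN; elim: k => [|k IH]; first by rewrite leqn0 => /eqP ->.
rewrite leq_eqVlt => /orP[/eqP -> //|]; rewrite ltnS => Nk /=.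
by rewrite IH // uN ?tg_mulg1.
Qed.

Lemma pprod_cvg (u : nat -> G) N : (forall n, (N < n)%N -> u n = e) ->
  pprod (@tg_mul G) u @ \oo --> pprod (@tg_mul G) u N.
Proof.
move=> uN; apply: cvg_near_cst; exists N => // k /= Nk; exact: pprod_const.
Qed.

Lemma pprod_lim (u : nat -> G) N l : (forall n, (N < n)%N -> u n = e) ->
  pprod (@tg_mul G) u @ \oo --> l -> l = pprod (@tg_mul G) u N.
Proof. by move=> /pprod_cvg uN ul; exact: (cvg_unique tg_hausdorff ul uN). Qed.

Lemma pprod_one (u : nat -> G) k : (forall n, u n = e) ->
  pprod (@tg_mul G) u k = e.
Proof. by move=> u1; elim: k => [|k IH] /=; rewrite ?u1 // IH tg_mul1g. Qed.

(** Exponents are chosen to push every nontrivial [u n] out of [U]. Convergence forces the quotients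
    of consecutive partial products, which are these powers, into [U] eventually. *)
Lemma nss_eventually_one (u : nat -> G) : NSS G ->
  (forall z, exists l : G, pprod (@tg_mul G) (fun n => zp (u n) (z n)) @ \oo --> l) ->
  exists N, forall n, (N <= n)%N -> u n = e.
Proof.
move=> [U [oU U1 nss]] cvu.
have /choice[z Hz] : forall n, exists z, u n <> e -> ~ U (zp (u n) z).
  move=> n; have [->|/(zpow_escape nss)[z Hz]] := pselect (u n = e).
    by exists 0.
  by exists z.
have [l cl] := cvu z; set P := pprod _ _ in cl.
have : (fun n => (P n)^- ** P n.+1) @ \oo --> e.
  rewrite -(tg_mulVg l); apply: tg_mul_cvg; first exact: tg_inv_cvg.
  by move=> A /cl[N _ HN]; exists N => // n /= Nn; apply: HN; exact: leqW.
move=> /(_ U) [|N _ HN]; first exact: open_nbhs_nbhs.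
exists N.+1 => -[//|n] Nn; apply: contrapT => /Hz; apply.
by have := HN n Nn; rewrite /P /= tg_mulA tg_mulVg tg_mul1g.
Qed.

End TopGroupTheory.

(** Stated for bare operations because it is applied to evaluations on [Cp X G] and coordinates of
    [prodG H], which are not packaged as a [topGroup]. *)
Lemma zpow_morph (T T' : topologicalType) (mul : T -> T -> T) (inv : T -> T) (e : T)
    (mul' : T' -> T' -> T') (inv' : T' -> T') (e' : T') (p : T -> T') :
  (forall x y, p (mul x y) = mul' (p x) (p y)) ->
  (forall x, p (inv x) = inv' (p x)) -> p e = e' ->
  forall x z, p (zpow mul inv e x z) = zpow mul' inv' e' (p x) z.
Proof.
move=> pM pV p1 x z.
have it n : p (iter n (mul x) e) = iter n (mul' (p x)) e'.
  by elim: n => //= n IH; rewrite pM IH.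
by case: z => n; rewrite /zpow ?pV it.
Qed.

Lemma pprod_morph (T T' : topologicalType) (mul : T -> T -> T) (mul' : T' -> T' -> T')
    (p : T -> T') :
  (forall x y, p (mul x y) = mul' (p x) (p y)) ->
  forall u k, p (pprod mul u k) = pprod mul' (p \o u) k.
Proof. by move=> pM u; elim=> //= k IH; rewrite pM IH. Qed.

Lemma Cp_pprod_eval (X : topologicalType) (G : topGroup) (a : nat -> Cp X G)
    (z : nat -> int) k x :
  sval (pprod (@Cp_mul X G)
    (fun n => zpow (@Cp_mul X G) (@Cp_inv X G) (@Cp_one X G) (a n) (z n)) k) x
  = pprod (@tg_mul G)
      (fun n => zpow (@tg_mul G) (@tg_inv G) (tg_one G) (sval (a n) x) (z n)) k.
Proof.
rewrite (@pprod_morph _ _ _ (@tg_mul G) (fun f : Cp X G => sval f x)) //.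
congr pprod; apply/funext => n /=.
by apply: (zpow_morph (p := fun f : Cp X G => sval f x)).
Qed.

Lemma infinite_set_sequence (T : Type) (A : set T) : infinite_set A ->
  exists2 a : nat -> T, injective a & forall n, A (a n).
Proof.
move=> /infiniteP/card_leP[f]; pose i n : [set: nat] := exist _ n (mem_set I).
exists (fun n => sval (f (i n))) => [m n|n]; last exact: set_mem (svalP (f (i n))).
by move=> /val_inj/(inj (f := f) (mem_set I) (mem_set I))[].
Qed.

(** * Pseudocompactness implies TAP *)

Section PseudocompactTAP.
Variables (G : topGroup) (X : topologicalType).
Hypotheses (nssG : NSS G) (tyX : tychonoff_space X) (pcX : pseudocompact X).
Local Notation "x ** y" := (tg_mul x y) (at level 40, left associativity).
Local Notation "x ^-" := (tg_inv x) (at level 3, format "x ^-").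
Local Notation e := (tg_one G).
Local Notation zp := (zpow (@tg_mul G) (@tg_inv G) e).
Local Notation pp := (pprod (@tg_mul G)).
Local Notation Cp_partial a z := (pprod (@Cp_mul X G)
  (fun n => zpow (@Cp_mul X G) (@Cp_inv X G) (@Cp_one X G) (a n) (z n))).

Lemma Cp_product_eval (a : nat -> Cp X G) (z : nat -> int) (l : Cp X G) x :
  Cp_partial a z @ \oo --> l ->
  pp (fun n => zp (sval (a n) x) (z n)) @ \oo --> sval l x.
Proof.
move=> /(@set_type_ptws_cvg _ _ (cont_set X G) _ l _) /(_ x).
apply: cvg_trans; apply: near_eq_cvg; apply: nearW => k.
by rewrite Cp_pprod_eval.
Qed.

Lemma Cp_point_finite (a : nat -> Cp X G) :
  (forall z, exists l : Cp X G, Cp_partial a z @ \oo --> l) ->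
  forall x, exists N, forall n, (N <= n)%N -> sval (a n) x = e.
Proof.
move=> cva x; apply: nss_eventually_one => // z; have [l cl] := cva z.
by exists (sval l x); exact: Cp_product_eval.
Qed.

Lemma triangular_sequence_diverges (a : nat -> Cp X G) (x : nat -> X) :
  (forall k, sval (a k) (x k) <> e) ->
  (forall k j, (k < j)%N -> sval (a j) (x k) = e) ->
  ~ forall z, exists l : Cp X G, Cp_partial a z @ \oo --> l.
Proof.
move=> ax1 ax0 cva; have pf := Cp_point_finite cva.
have [U [oU U1 nss]] := nssG.
(* [V] is what the products must avoid at the points [x k]; [W] leaves room for moving from [x k] to
   a nearby point. *)
have [V nV VU] := nbhs1_div (open_nbhs_nbhs (conj oU U1)).
have [W nW WV] := nbhs1_mul nV.
have /choice[zk Hzk] k := zpow_escape nss (ax1 k).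
(* The exponent of [a k] is used only to push the partial product out of [V]
   at [x k]: if both the old and the new value were in [V], their quotient
   [a k (x k) ^ zk k] would be in [U]. *)
pose eps N k (Q : X -> G) : int :=
  if (N <= k)%N && `[< V (Q (x k)) >] then zk k else 0.
(* The recursion builds whole functions of [y], since the next exponent depends on the value at
   [x k'] and not at [y]. *)
pose P N := fix P k (y : X) : G :=
  if k is k'.+1 then P k' y ** zp (sval (a k') y) (eps N k' (P k')) else e.
pose z N k := eps N k (P N k).
(* [pprod] up to [k] includes factor [k], whereas [P N k] stops before it. *)
have PE N y k : pp (fun n => zp (sval (a n) y) (z N n)) k = P N k.+1 y.
  by elim: k => [|k IH] /=; [rewrite tg_mul1g|rewrite IH].
have /choice[l Hl] N := cva (z N).
(* Factors after [k] are trivial at [x k], so the limit there is the partial product right after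
   exponent [k] was chosen. *)
have lx N k : (N <= k)%N -> ~ V (sval (l N) (x k)).
  move=> Nk.
  rewrite (pprod_lim (N := k) _ (Cp_product_eval (x := x k) (Hl N))); last first.
    by move=> n kn; rewrite ax0 // zpow_one.
  rewrite PE /= /eps Nk /=; case: asboolP => [VP VPz|]; last by rewrite tg_mulg1.
  by apply: (Hzk k); have := VU _ _ VP VPz; rewrite tg_mulA tg_mulVg tg_mul1g.
have lc N : continuous (sval (l N)) by exact: set_mem (svalP (l N)).
(* Only the indices [N <= k] are controlled, so this is a finite intersection of neighbourhoods of
   [x k]. *)
pose O k := [set y | forall N : 'I_k.+1,
  W ((sval (l N) y)^- ** sval (l N) (x k))].
have nO k : nbhs (x k) (O k).
  apply: filter_forall => N.
  have : (fun y => (sval (l N) y)^- ** sval (l N) (x k)) @ x k --> e.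
    rewrite -(tg_mulVg (sval (l N) (x k))).
    by apply: tg_mul_cvg; [apply: tg_inv_cvg; exact: lc|exact: cvg_cst].
  by apply.
have [p clp] := pseudocompact_cluster tyX pcX nO.
have [N aN] := pf p.
(* Exponents vanish before [N], and the maps are trivial at [p] from [N] on. *)
have lp : sval (l N) p = e.
  have ue n : zp (sval (a n) p) (z N n) = e.
    by rewrite /z /eps; case: leqP => [/aN ->|//]; rewrite zpow_one.
  rewrite (pprod_lim (N := 0%N) _ (Cp_product_eval (x := p) (Hl N))) ?pprod_one //.
have nB : nbhs p [set y | W (sval (l N) y)] by apply: lc; rewrite lp.
have [k Nk [y [By Oy]]] := clp _ nB N.
apply: (lx N k Nk).
have /= := Oy (Ordinal (Nk : (N < k.+1)%N)) => Wy.
by have := WV _ _ By Wy; rewrite tg_mulA tg_mulgV tg_mul1g.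
Qed.

Lemma pseudocompact_TAP : TAP (@Cp_mul X G) (@Cp_inv X G) (@Cp_one X G).
Proof.
move=> A Aap; apply: contrapT => /infinite_set_sequence[a0 a0_inj Aa0].
(* By injectivity the identity occurs at most once, so dropping an initial segment removes it. *)
have [a [a_inj Aa a1]] : exists a : nat -> Cp X G, [/\ injective a, (forall n, A (a n)) &
    forall n, a n <> Cp_one X G].
  have [[n0 an0]|H] := pselect (exists n, a0 n = Cp_one X G); last first.
    by exists a0; split=> // n an; apply: H; exists n.
  exists (fun n => a0 (n0.+1 + n)%N); split=> // [m n /a0_inj/addnI //|n].
  by rewrite -an0 => /a0_inj; lia.
have /choice[x Hx] : forall n, exists x, sval (a n) x <> e.
  move=> n; apply: contrapT => H; apply: (a1 n); apply: val_inj.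
  by apply/funext => x; apply: contrapT => Hx; apply: H; exists x.
have /choice[N HN] := Cp_point_finite (Aap a a_inj Aa).
(* The first bound makes [s] strictly increasing; the second makes all later terms trivial at the
   point already selected. *)
pose s := fix s k := if k is k'.+1 then maxn (s k').+1 (N (x (s k'))) else 0%N.
have s_lt k : (s k < s k.+1)%N by exact: leq_maxl.
have s_mono : {homo s : k j / (k < j)%N} by exact: homo_ltn ltn_trans s_lt.
have s_le := homo_leq leqnn leq_trans (fun k => ltnW (s_lt k)).
have s_inj : injective s.
  move=> k j skj; case: (ltngtP k j) => // /s_mono; by rewrite skj ltnn.
apply: (@triangular_sequence_diverges (a \o s) (x \o s)).
- by move=> k; exact: Hx.
- move=> k j kj; apply: HN; apply: leq_trans (s_le _ _ kj); exact: leq_maxr.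
- by apply: (Aap (a \o s)) => [|n]; [exact: inj_comp|exact: Aa].
Qed.

End PseudocompactTAP.

(** * Infinite products violate TAP *)

Lemma infinite_product_not_TAP (X : topologicalType) (G : topGroup) :
  Cp_contains_infinite_product X G ->
  ~ TAP (@Cp_mul X G) (@Cp_inv X G) (@Cp_one X G).
Proof.
move=> [I [H [phi [[infI ntI] phiM phi_inj phi_c _]]]] tap.
have /all_sig[h hP] i := cid (ntI i).
pose one : prodG H := fun i => tg_one (H i).
pose inv (b : prodG H) : prodG H := fun i => tg_inv (b i).
have phi1 : phi one = Cp_one X G.
  apply: val_inj; apply/funext => x; apply: tg_idem1.
  have := congr1 (fun c => sval c x) (phiM one one).
  have -> : prodG_mul one one = one; last by [].
  by apply: functional_extensionality_dep => i; exact: tg_mul1g.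
have phiV b : phi (inv b) = Cp_inv (phi b).
  apply: val_inj; apply/funext => x; apply: tg_inv_uniq.
  have := congr1 (fun c => sval c x) (phiM b (inv b)).
  have -> : prodG_mul b (inv b) = one.
    by apply: functional_extensionality_dep => i; exact: tg_mulgV.
  by rewrite phi1.
pose d i : prodG H := fun j => if `[< i = j >] then h j else tg_one (H j).
have d_inj : injective d.
  move=> i j dij; apply: contrapT => ij; apply: (hP i).
  have := congr1 (fun b : prodG H => b i) dij; rewrite /d asboolT //.
  by rewrite asboolF // => ji; exact/ij/esym.
have : finite_set (range (phi \o d)).
  apply: tap => a a_inj /= Aa z.
  have /choice[k Hk] : forall n, exists i, phi (d i) = a n.
    by move=> n; have [i _ <-] := Aa n; exists i.
  have k_inj : injective k by move=> m n kmn; apply: a_inj; rewrite -!Hk kmn.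
  (* Since [k] is injective, at most one [d (k n)] is nontrivial at coordinate [j], so the partial
     products stabilise in each coordinate. *)
  have /choice[N HN] : forall j, exists N, forall n, (N < n)%N ->
      d (k n) j = tg_one (H j).
    move=> j; have [[n0 kn0]|nk] := pselect (exists n, k n = j).
      exists n0 => n n0n; rewrite /d asboolF // -kn0 => /k_inj nn0.
      by rewrite nn0 ltnn in n0n.
    by exists 0%N => n _; rewrite /d asboolF // => knj; apply: nk; exists n.
  pose u n := zpow (@prodG_mul I H) inv one (d (k n)) (z n).
  pose l : prodG H := fun j => pprod (@tg_mul (H j)) (fun n => u n j) (N j).
  exists (phi l).
  have -> : (fun n => zpow (@Cp_mul X G) (@Cp_inv X G) (Cp_one X G) (a n) (z n))
      = phi \o u.
    by apply/funext => n /=; rewrite /u -Hk (zpow_morph phiM phiV phi1).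
  have -> : pprod (@Cp_mul X G) (phi \o u) = phi \o pprod (@prodG_mul I H) u.
    by apply/funext => n /=; rewrite (pprod_morph phiM).
  suff ul : pprod (@prodG_mul I H) u @ \oo --> l by exact: cvg_comp ul (phi_c l).
  apply: (proj2 (@prod_topology_cvg I (fun i => tg_car (H i)) _ l _)) => j.
  have uE : (fun n => pprod (@prodG_mul I H) u n j) =
      pprod (@tg_mul (H j)) (fun n => u n j).
    apply/funext => n.
    exact: (@pprod_morph _ _ _ (@tg_mul (H j)) (fun q : prodG H => q j)).
  suff : (fun n => pprod (@prodG_mul I H) u n j) @ \oo --> l j by [].
  rewrite uE; apply: pprod_cvg => n Nn.
  rewrite /u (@zpow_morph _ _ _ _ _ (@tg_mul (H j)) (@tg_inv (H j))
    (tg_one (H j)) (fun q : prodG H => q j)) //.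
  by rewrite HN // zpow_one.
rewrite (eq_finite_set (inj_card_eq _)) // => i j _ _.
by move=> /phi_inj/d_inj.
Qed.

(** * Embedding an infinite product when the space is not pseudocompact *)

Lemma unbounded_separated (R : realType) (X : topologicalType) (f : X -> R) :
  continuous f -> (forall M : R, exists x, M < `|f x|) ->
  exists (O : nat -> set X) (x : nat -> X),
    [/\ forall n, open (O n), forall n, O n (x n) &
     forall p : X, exists2 B : set X, nbhs p B &
       exists n, forall y m, B y -> O m y -> m = n].
Proof.
move=> cf /choice[s Hs].
pose g y := `|f y|.
have cg c : continuous (fun y => `|g y - c|).
  move=> y; apply: cvg_norm; apply: cvgB; last exact: cvg_cst.
  by apply: cvg_norm; exact: cf.
have og c (r : R) : open [set y | `|g y - c| < r].
  by have /continuousP/(_ [set t | t < r]) := cg c; apply; exact: open_lt.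
pose x := fix x n := if n is n'.+1 then s (g (x n') + 1) else s 0.
have gx i j : (i < j)%N -> g (x i) + 1 < g (x j).
  apply: (@homo_ltn _ x (fun a b => g a + 1 < g b)) => [b a c ab bc|n].
    lra.
  exact: Hs.
(* With radius 1/4 for [B] as well, two bands meeting [B] have centres less than 4/4 apart, while
   distinct centres differ by more than 1. *)
exists (fun n => [set y | `|g y - g (x n)| < 1 / 4%:R]), x; split=> //.
  by move=> n /=; rewrite subrr normr0; lra.
move=> p; pose B := [set y | `|g y - g p| < 1 / 4%:R]; exists B.
  apply: open_nbhs_nbhs; split; first exact: og.
  by rewrite /B /= subrr normr0; lra.
have [[m [y [By Oy]]]|H] := pselect (exists m y, B y /\
    `|g y - g (x m)| < 1 / 4%:R); last first.
  by exists 0%N => y m By Oy; exfalso; apply: H; exists m, y.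
exists m => y' m' By' Oy'; move: By Oy By' Oy'; rewrite /B /= !ltr_norml.
move=> /andP[? ?] /andP[? ?] /andP[? ?] /andP[? ?].
by case: (ltngtP m' m) => // /gx ?; exfalso; lra.
Qed.

Section SupportedMaps.
Variables (X : topologicalType) (G : topGroup) (O : set X).

(** Support is meant without closure: the maps are trivial off [O] itself. These groups become the
    factors of the product. *)
Definition supported_set : set {ptws X -> G} :=
  [set f | continuous (f : X -> G) /\ forall y, ~ O y -> f y = tg_one G].

Lemma supported_mul_subproof (f g : set_type supported_set) :
  supported_set (fun x => tg_mul (sval f x) (sval g x)).
Proof.
have [[cf f1] [cg g1]] := (set_mem (svalP f), set_mem (svalP g)).
split=> [|y Oy] /=.
  exact: cont_mul.
by rewrite f1 // g1 // tg_mul1g.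
Qed.

Lemma supported_inv_subproof (f : set_type supported_set) :
  supported_set (fun x => tg_inv (sval f x)).
Proof.
have [cf f1] := set_mem (svalP f); split=> [|y Oy] /=; first exact: cont_inv.
by rewrite f1 // tg_inv1.
Qed.

Lemma supported_one_subproof : supported_set (fun=> tg_one G).
Proof. by split=> // x; exact: cvg_cst. Qed.

Definition supported_mul (f g : set_type supported_set) :
    set_type supported_set := exist _ (fun x => tg_mul (sval f x) (sval g x) : G)
    (mem_set (supported_mul_subproof f g)).

Definition supported_inv (f : set_type supported_set) :
    set_type supported_set := exist _ (fun x => tg_inv (sval f x) : G)
    (mem_set (supported_inv_subproof f)).

Definition supported_one : set_type supported_set :=
  exist _ (fun=> tg_one G) (mem_set supported_one_subproof).

Lemma supported_is_topgroup :
  is_topgroup supported_mul supported_inv supported_one.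
Proof.
split.
- by move=> f g h; apply: val_inj; apply/funext => x; exact: tg_mulA.
- split=> f; split; apply: val_inj; apply/funext => x.
  + exact: tg_mul1g.
  + exact: tg_mulg1.
  + exact: tg_mulVg.
  + exact: tg_mulgV.
- apply/set_type_ptws_continuous => x [f g]; apply: tg_mul_cvg.
    by apply: set_type_ptws_eval_cvg; exact: cvg_fst.
  by apply: set_type_ptws_eval_cvg; exact: cvg_snd.
- apply/set_type_ptws_continuous => x f; apply: (@tg_inv_cvg G _ (nbhs f)).
  exact: set_type_ptws_eval_continuous.
- exact/set_type_ptws_hausdorff/tg_hausdorff.
Qed.

Definition supportedG : topGroup := TopGroup supported_is_topgroup.

End SupportedMaps.

Lemma contains_infinite_product (X : topologicalType) (G : topGroup) :
  G_regular G X -> ~ pseudocompact X -> Cp_contains_infinite_product X G.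
Proof.
move=> regX npc.
have [f cf fub] : exists2 f : X -> Rdefinitions.R, continuous f &
    forall M, exists x, M < `|f x|.
  apply: contrapT => H; apply: npc => f cf; apply: contrapT => nM; apply: H.
  exists f => // M; apply: contrapT => Mx; apply: nM; exists M => x.
  by rewrite leNgt; apply/negP => ?; apply: Mx; exists x.
have [O [x [oO Ox sepO]]] := unbounded_separated cf fub.
(* [N y] is the only possible index of a set [O m] containing [y]. If there is none, its value is
   immaterial, as every supported map is trivial at [y]. *)
have /choice[N HN] : forall y, exists n, forall m, O m y -> m = n.
  move=> y; have [B /nbhs_singleton By [n Bn]] := sepO y.
  by exists n => m; exact: Bn.
pose H n := supportedG G (O n).
have H1 n (h : H n) y : ~ O n y -> sval h y = tg_one G.
  by have [_] := set_mem (svalP h); apply.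
have phiE (h : prodG H) n y : (forall m, O m y -> m = n) ->
    sval (h (N y)) y = sval (h n) y.
  move=> On; have [-> //|/eqP Nn] := eqVneq (N y) n.
  by rewrite !H1 // => [/HN /esym//|/On].
have phi_cont (h : prodG H) : cont_set X G (fun y => sval (h (N y)) y).
  move=> p; have [B pB [n Bn]] := sepO p.
  have ch : continuous (sval (h n)) by have [] := set_mem (svalP (h n)).
  change ((fun y => sval (h (N y)) y : G) @ p --> sval (h (N p)) p).
  rewrite (phiE h n p); last by move=> m; apply: Bn; exact: nbhs_singleton pB.
  apply: cvg_trans (ch p); apply: near_eq_cvg; apply: filterS pB => y By.
  by rewrite (phiE h n y) // => m; exact: Bn.
pose phi (h : prodG H) : Cp X G := exist _ (fun y => sval (h (N y)) y : G)
  (mem_set (phi_cont h)).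
have phiO (h : prodG H) n y : O n y -> sval (phi h) y = sval (h n) y.
  by move=> /= /HN ->.
exists nat, H, phi; split.
- split=> [|n]; first exact: infinite_nat.
  have [|| g [c [cg c1 gx g0]]] := regX (~` O n) (x n).
  + exact: open_closedC.
  + by apply; exact: Ox.
  have sg : @supported_set X G (O n) g by [].
  exists (exist _ g (mem_set sg) : H n) => /(congr1 (fun h => sval h (x n))).
  by rewrite /= gx.
- by move=> a b; apply: val_inj.
- move=> a b ab; apply: functional_extensionality_dep => n.
  apply: val_inj; apply/funext => y.
  change (sval (a n) y = sval (b n) y).
  have [Oy|Oy] := pselect (O n y); last by rewrite !H1.
  by rewrite -!(phiO _ n y) // ab.
- apply/set_type_ptws_continuous => y h /=.
  apply: set_type_ptws_eval_cvg.
  exact: (proj1 (@prod_topology_cvg _ (fun n => tg_car (H n)) (nbhs h) h _)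
    (@cvg_id _ (nbhs h))).
- move=> U oU.
  (* This is the largest open set whose preimage lies in [U]. That it covers the image of [U]
     amounts to convergence to [b] of the filter [F] of preimages of neighbourhoods of [phi b]. *)
  exists (\bigcup_(W in [set W | open W /\ phi @^-1` W `<=` U]) W).
  split; first by apply: bigcup_open => W [].
  apply/seteqP; split=> [_ [b Ub <-]|c [[W [_ WU] Wc] [b _ bc]]]; last first.
    by exists b => //; apply: WU; rewrite /= bc.
  split; last by exists b.
  pose F := filter_from (nbhs (phi b)) (fun W => phi @^-1` W).
  have FF : Filter F.
    apply: filter_from_filter; first by exists setT; exact: filterT.
    by move=> A B nA nB; exists (A `&` B); first exact: filterI.
  suff Fb : F --> b.
    have [W nW WU] := Fb _ (open_nbhs_nbhs (conj oU Ub)).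
    exists W^°; last exact: nW.
    by split; [exact: open_interior|move=> c /interior_subset; exact: WU].
  apply/prod_topology_cvg => n; apply/set_type_ptws_cvg => y A nA.
  (* Off [O n] the coordinate is constantly the identity; on [O n] it is read off from [phi h] by
     evaluation at [y]. *)
  have [Oy|Oy] := pselect (O n y); last first.
    exists setT; first exact: filterT.
    by move=> h _ /=; rewrite H1 // -(H1 n (b n) y Oy); exact: nbhs_singleton nA.
  exists [set c | A (sval c y)].
    apply: (@set_type_ptws_eval_continuous _ _ (cont_set X G) y (phi b) A).
    by rewrite (phiO b n y).
  by move=> h /=; rewrite (HN y n Oy).
Qed.

Theorem theorem6p5 (G : topGroup) (X : topologicalType) :
  NSS G -> tychonoff_space X -> (exists x : X, True) -> G_regular G X ->
  (pseudocompact X <-> TAP (@Cp_mul X G) (@Cp_inv X G) (@Cp_one X G)) /\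
  (pseudocompact X <-> ~ Cp_contains_infinite_product X G).
Proof.
move=> nss ty _ reg.
have i_ii : pseudocompact X -> TAP (@Cp_mul X G) (@Cp_inv X G) (@Cp_one X G).
  exact: pseudocompact_TAP.
have iii_i : ~ Cp_contains_infinite_product X G -> pseudocompact X.
  by move=> H; apply: contrapT => /(contains_infinite_product reg).
have ii_iii : TAP (@Cp_mul X G) (@Cp_inv X G) (@Cp_one X G) ->
    ~ Cp_contains_infinite_product X G.
  by move=> tap /infinite_product_not_TAP.
split; split=> //; first by move=> /ii_iii/iii_i.
by move=> /i_ii/ii_iii.
Qed.
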